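(* Let $a,b\in I$ with $a<s_0<b$. Let $f:[a,b]\to\mathbb{R}$ be an absolutely $\beta$-integrable function on $[a,b]$, and suppose that there exist real numbers $m$ and $M$ such that $m\le f(x)\le M$ for all $x\in[a,b]_\beta$. If $u:[a,b]\to\mathbb{R}$ is $\beta$-$L$-Lipschitzian on $[a,b]$ and $u(s_0^+)=u(s_0^-)$, then $$\left|\int_a^b f(x)\,d_\beta u(x)-\frac{u(b)-u(a)}{b-a}\int_a^b f(t)\,d_\beta t\right|\le\frac12 L(M-m)(b-a).$$ In particular, this is true when $u$ is $\beta$-$L$-Lipschitzian on $[a,b]$ and continuous at $s_0$. The constant $\frac12$ is the best possible: there is no constant $c<\frac12$ such that the inequality with $\frac12$ replaced by $c$ holds for all admissible data $(I,\beta,a,b,f,u,m,M,L)$.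
   Context: Setting: $I\subseteq\mathbb{R}$ is an interval and $\beta:I\to I$ is a strictly increasing continuous function with exactly one fixed point $s_0\in I$, satisfying $(t-s_0)(\beta(t)-t)\le 0$ for all $t\in I$, with equality only if $t=s_0$. Write $\beta^0(t)=t$ and $\beta^k$ for the $k$-fold composition of $\beta$ with itself. For $a,b\in I$, $[a,b]_\beta:=\{\beta^k(a):k\ge 0\}\cup\{\beta^k(b):k\ge 0\}\cup\{s_0\}$. The $\beta$-integral is $\int_a^b h\,d_\beta:=\int_{s_0}^b h\,d_\beta-\int_{s_0}^a h\,d_\beta$, where $\int_{s_0}^x h\,d_\beta:=\sum_{k=0}^{\infty}\big(\beta^k(x)-\beta^{k+1}(x)\big)h\big(\beta^k(x)\big)$; also written $\int_a^b h(x)\,d_\beta x$. The function $h$ is $\beta$-integrable on $[a,b]$ if these series converge for $x=a$ and $x=b$, and absolutely $\beta$-integrable on $[a,b]$ if $|h|$ is $\beta$-integrable on $[a,b]$. Riemann–Stieltjes $\beta$-integral: for a real function $u$ of bounded variation on $[a,b]_\beta$, $$\int_a^b f(x)\,d_\beta u(x):=\sum_{k=0}^\infty f(\beta^k(b))\big(u(\beta^k(b))-u(\beta^{k+1}(b))\big)-\sum_{k=0}^\infty f(\beta^k(a))\big(u(\beta^k(a))-u(\beta^{k+1}(a))\big).$$ A real function $u$ is $\beta$-$L$-Lipschitzian on $[a,b]$ if $|u(x)-u(\beta(x))|\le L|x-\beta(x)|$ for all $x\in[a,b]_\beta$. (Such a function is automatically of bounded variation on $[a,b]_\beta$.) Notation: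 $u(s_0^+):=\lim_{n\to\infty}u(\beta^n(b))$ and $u(s_0^-):=\lim_{n\to\infty}u(\beta^n(a))$; the hypothesis $u(s_0^+)=u(s_0^-)$ means that both limits exist and coincide. *)

(* Defs.v *)
From HB Require Import structures.
From mathcomp Require Import all_boot all_order all_algebra.
From mathcomp Require Import all_classical all_reals all_analysis.

Set Implicit Arguments.
Unset Strict Implicit.
Unset Printing Implicit Defensive.

Import Order.TTheory GRing.Theory Num.Theory.
Import numFieldNormedType.Exports.

Local Open Scope classical_set_scope.
Local Open Scope ring_scope.

(** Functions defined on [I] or on [[a, b]] are represented by total functions
    [R -> R]; their values outside of the domain are never constrained or used. *)

Section BetaCalculus.
Variable R : realType.
Implicit Types (I : set R) (beta f h u : R -> R) (a b x m M L : R).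

Record beta_setting I beta s0 : Prop := BetaSetting {
  bs_interval : is_interval I ;
  bs_stable : forall t, I t -> I (beta t) ;
  bs_increasing : forall s t, I s -> I t -> s < t -> beta s < beta t ;
  bs_continuous : {within I, continuous beta} ;
  bs_fixed_in : I s0 ;
  bs_fixed : beta s0 = s0 ;
  bs_fixed_unique : forall t, I t -> beta t = t -> t = s0 ;
  bs_sign : forall t, I t -> (t - s0) * (beta t - t) <= 0 ;
  bs_sign_eq : forall t, I t -> (t - s0) * (beta t - t) = 0 -> t = s0 }.

Definition beta_interval beta s0 a b : set R :=
  range (fun k => iter k beta a) `|` range (fun k => iter k beta b)
  `|` [set s0].

Definition beta_term beta h x : R^nat :=
  fun k => (iter k beta x - iter k.+1 beta x) * h (iter k beta x).

(** The integral from [s0] to [x]; the formula does not involve [s0]. *)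
Definition beta_integral0 beta h x : R := limn (series (beta_term beta h x)).

Definition beta_integral beta a b h : R :=
  beta_integral0 beta h b - beta_integral0 beta h a.

Definition beta_integrable beta a b h : Prop :=
  cvgn (series (beta_term beta h a)) /\ cvgn (series (beta_term beta h b)).

Definition abs_beta_integrable beta a b h : Prop :=
  beta_integrable beta a b (fun x => `|h x|).

(** The next two definitions make sense when the series converge, e.g. for [f]
    bounded and [u] of bounded variation on [beta_interval beta s0 a b]; the
    latter holds as soon as [u] is [beta_lipschitz]. *)
Definition beta_RS_integral0 beta f u x : R :=
  limn (series (fun k =>
    f (iter k beta x) * (u (iter k beta x) - u (iter k.+1 beta x)))).

Definition beta_RS_integral beta a b f u : R :=
  beta_RS_integral0 beta f u b - beta_RS_integral0 beta f u a.

Definition beta_lipschitz beta s0 a b L u : Prop :=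
  forall x, beta_interval beta s0 a b x ->
    `|u x - u (beta x)| <= L * `|x - beta x|.

(** [u(s0^+) = u(s0^-)]. *)
Definition beta_limits_agree beta a b u : Prop :=
  [/\ cvgn (fun n => u (iter n beta b)),
      cvgn (fun n => u (iter n beta a)) &
      limn (fun n => u (iter n beta b)) = limn (fun n => u (iter n beta a))].

(** All the hypotheses except the one on the behaviour of [u] near [s0]. *)
Record gruss_data I beta s0 a b f u m M L : Prop := GrussData {
  gd_setting : beta_setting I beta s0 ;
  gd_a_in : I a ;
  gd_b_in : I b ;
  gd_a_lt : a < s0 ;
  gd_lt_b : s0 < b ;
  gd_integrable : abs_beta_integrable beta a b f ;
  gd_bounds : forall x, beta_interval beta s0 a b x -> m <= f x <= M ;
  gd_lipschitz : beta_lipschitz beta s0 a b L u }.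

End BetaCalculus.

(* Main.v *)
Require Import Defs.
From mathcomp Require Import all_boot all_order all_algebra.
From mathcomp Require Import all_classical all_reals all_analysis.
From mathcomp Require Import ring lra.
Import Order.TTheory GRing.Theory Num.Theory.
Import numFieldNormedType.Exports.
Local Open Scope classical_set_scope.
Local Open Scope ring_scope.

(** Telescoping along the two orbits, both integrals are series indexed by the
    orbit steps: step [k] has a positive weight [w] (with total weight [b - a]),
    an increment [d] of [u] with [|d| <= L w], and a value [f] of the integrand.
    If [v = (u b - u a) / (b - a)] and [c = (m + M) / 2], then
    [sum (d - v w) = 0], so the left-hand side is [|sum (f - c) (d - v w)|],
    at most [(M - m) / 2 * sum |d - v w|]. Finally
    [|d - v w| <= L w - (v / L) d] when [|d| <= L w] and [|v| <= L], and the
    right-hand sides add up to [(L - v^2 / L) (b - a) <= L (b - a)].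
    Equality holds for [beta t = t / 2], [a = -1], [b = 1], [f = sgn],
    [u = |.|]. *)

(** * Telescoping series and the termwise estimate *)

Lemma series_telescope {R : realType} {y : R^nat} {l : R} :
  y @ \oo --> l ->
  series (fun k => y k - y k.+1) @ \oo --> y 0%N - l.
Proof.
move=> yl; have -> : series (fun k => y k - y k.+1) = fun n => y 0%N - y n.
  apply/funext => n; rewrite seriesEnat /= -[RHS]opprB -telescope_sumr // -sumrN.
  by apply: eq_bigr => k _; rewrite opprB.
by apply: cvgB yl; exact: cvg_cst.
Qed.

Lemma series_scale {R : realType} {y : R^nat} {l : R} (e : R) :
  series y @ \oo --> l -> series (fun k => e * y k) @ \oo --> e * l.
Proof.
move=> yl; have -> : series (fun k => e * y k) = e *: series y.
  by rewrite -seriesZ.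
exact: cvgZr.
Qed.

(* For [L = 0] both sides vanish, since [v / 0 = 0]. *)
Lemma dist_scaled_le {R : realFieldType} (L v w d : R) :
  `|v| <= L -> `|d| <= L * w -> `|d - v * w| <= L * w - v / L * d.
Proof.
move=> vL dL; have : 0 <= L by apply: le_trans vL.
rewrite le_eqVlt => /predU1P[L0|L0].
  move: vL dL; rewrite -L0 !mul0r !normr_le0 => /eqP -> /eqP ->.
  by rewrite !mul0r subrr normr0.
move: vL dL; rewrite !ler_norml => /andP[v1 v2] /andP[d1 d2].
(* Both halves of the absolute-value bound factor into quantities made nonnegative by [|d| <= L w]
   and [|v| <= L]. *)
have e1 : L * w - v / L * d - (d - v * w) = (L * w - d) * (L + v) / L.
  by field; rewrite gt_eqF.
have e2 : (d - v * w) + (L * w - v / L * d) = (d + L * w) * (L - v) / L.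
  by field; rewrite gt_eqF.
rewrite -subr_ge0 opprK e2 -[X in _ && X]subr_ge0 e1.
by rewrite !divr_ge0 ?mulr_ge0 //; lra.
Qed.

(** The bound holds for partial sums, term by term via [dist_scaled_le], and passes to the limit.
    The term [v / L * D] is kept because only the sum over both endpoints has a known sign. *)
Lemma gruss_series {R : realType} {f d w : R^nat} {A B D W : R} (c K L v : R) :
  (forall k, `|d k| <= L * w k) ->
  (forall k, `|f k - c| <= K) -> `|v| <= L ->
  series (fun k => f k * d k) @ \oo --> A ->
  series (fun k => f k * w k) @ \oo --> B ->
  series d @ \oo --> D -> series w @ \oo --> W ->
  `|A - v * B - c * (D - v * W)| <= K * (L * W - v / L * D).
Proof.
move=> dL fK vL cA cB cD cW.
have cl : (fun n => `|series (fun k => f k * d k) n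
     - v * series (fun k => f k * w k) n - c * (series d n - v * series w n)|)
     @ \oo --> `|A - v * B - c * (D - v * W)|.
  apply: cvg_norm; apply: cvgB; first by apply: cvgB => //; exact: cvgMr.
  by apply: cvgMr; apply: cvgB => //; exact: cvgMr.
have cr : (fun n => K * (L * series w n - v / L * series d n))
     @ \oo --> K * (L * W - v / L * D).
  by apply: cvgMr; apply: cvgB; exact: cvgMr.
apply: (ler_cvg_to cl cr); apply: nearW => n.
rewrite !seriesEnat /= !(mulr_sumr, =^~ sumrB).
apply: le_trans (ler_norm_sum _ _ _) _; apply: ler_sum => k _.
rewrite (_ : _ - _ = (f k - c) * (d k - v * w k)); last by ring.
by rewrite normrM ler_pM // dist_scaled_le.
Qed.

(** * Orbits of [beta] and the estimate at one endpoint *)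

Section BetaIterates.
Context {R : realType} {I : set R} {beta : R -> R} {s0 : R}.
Hypothesis bs : beta_setting I beta s0.

Lemma beta_iter_in {x} k : I x -> I (iter k beta x).
Proof. by move=> Ix; elim: k => //= k; exact: bs_stable bs _. Qed.

Lemma beta_mono {x y} : I x -> I y -> x <= y -> beta x <= beta y.
Proof.
move=> Ix Iy; rewrite le_eqVlt => /predU1P[-> //|xy].
exact/ltW/(bs_increasing bs).
Qed.

(** Monotonicity prevents [beta] from crossing its fixed point, and the sign condition moves points
    towards it; hence orbits are monotone and bounded by [s0]. *)
Lemma beta_right {x} : I x -> s0 <= x -> s0 <= beta x <= x.
Proof.
move=> Ix sx; have Is := bs_fixed_in bs.
rewrite -{1}(bs_fixed bs) beta_mono //=.
move: sx; rewrite le_eqVlt => /predU1P[<-|sx]; first by rewrite (bs_fixed bs).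
by have := bs_sign bs Ix; rewrite pmulr_rle0 ?subr_gt0 // subr_le0.
Qed.

Lemma beta_left {x} : I x -> x <= s0 -> x <= beta x <= s0.
Proof.
move=> Ix xs; have Is := bs_fixed_in bs.
rewrite -{1}(bs_fixed bs) beta_mono // andbT.
move: xs; rewrite le_eqVlt => /predU1P[->|xs]; first by rewrite (bs_fixed bs).
by have := bs_sign bs Ix; rewrite nmulr_rle0 ?subr_lt0 // subr_ge0.
Qed.

Lemma beta_iter_right {x} k : I x -> s0 <= x ->
  s0 <= iter k.+1 beta x <= iter k beta x.
Proof.
move=> Ix sx; apply: beta_right; first exact: beta_iter_in.
elim: k => //= k ih; by have /andP[] := beta_right (beta_iter_in k Ix) ih.
Qed.

Lemma beta_iter_left {x} k : I x -> x <= s0 ->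
  iter k beta x <= iter k.+1 beta x <= s0.
Proof.
move=> Ix xs; apply: beta_left; first exact: beta_iter_in.
elim: k => //= k ih; by have /andP[] := beta_left (beta_iter_in k Ix) ih.
Qed.

Lemma beta_iter_limit_fixed {x l} : I x -> I l ->
  iter n beta x @[n --> \oo] --> l -> l = s0.
Proof.
move=> Ix Il xl; apply: (bs_fixed_unique bs) => //.
have xl1 : iter n.+1 beta x @[n --> \oo] --> l.
  by move: xl; rewrite -(cvg_shiftS (fun n => iter n beta x)).
have /subspace_continuousP/(_ l Il) cl := bs_continuous bs.
suff : iter n.+1 beta x @[n --> \oo] --> beta l.
  by move=> h; apply: (cvg_unique _ h xl1).
apply: (@cvg_comp _ _ _ (fun n => iter n beta x) beta _ _ _ _ cl).
(* Continuity is only relative to [I], so the limit is taken in the trace filter; this suffices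
   because the orbit stays in [I]. *)
move=> P /xl lP.
have {}lP : \forall n \near \oo, I (iter n beta x) -> P (iter n beta x).
  exact: lP.
apply: filterS lP => n /=; apply; exact: beta_iter_in.
Qed.

(** A monotone bounded orbit has a limit; it lies between [s0] and [x], hence in the interval [I],
    where [s0] is the only possible limit. *)
Lemma beta_iter_cvg {x} : I x -> iter n beta x @[n --> \oo] --> s0.
Proof.
move=> Ix; have Is := bs_fixed_in bs.
suff [l Il xl] : exists2 l, I l & iter n beta x @[n --> \oo] --> l.
  by rewrite -(beta_iter_limit_fixed Ix Il xl).
case: (leP s0 x) => [sx|/ltW xs].
- have dec : nonincreasing_seq (fun n => iter n beta x).
    by apply/nonincreasing_seqP => n; case/andP: (beta_iter_right n Ix sx).
  have lb n : s0 <= iter n beta x.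
    by case: n => //= n; case/andP: (beta_iter_right n Ix sx).
  have cv : cvgn (fun n => iter n beta x).
    by apply: nonincreasing_is_cvgn => //; exists s0 => _ [n _ <-].
  exists (limn (fun n => iter n beta x)) => //.
  apply: (bs_interval bs Is Ix); apply/andP; split.
    by apply: limr_ge => //; apply: nearW.
  exact: (nonincreasing_cvgn_ge dec cv 0%N).
- have inc : nondecreasing_seq (fun n => iter n beta x).
    by apply/nondecreasing_seqP => n; case/andP: (beta_iter_left n Ix xs).
  have ub n : iter n beta x <= s0.
    by case: n => //= n; case/andP: (beta_iter_left n Ix xs).
  have cv : cvgn (fun n => iter n beta x).
    by apply: nondecreasing_is_cvgn => //; exists s0 => _ [n _ <-].
  exists (limn (fun n => iter n beta x)) => //.
  apply: (bs_interval bs Ix Is); apply/andP; split.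
    exact: (nondecreasing_cvgn_le inc cv 0%N).
  by apply: limr_le => //; apply: nearW.
Qed.

(* The sign [e] makes the increments [e * (x - beta x)] nonnegative, so that
   the endpoints [b] ([e = 1]) and [a] ([e = -1]) are treated at once. *)
Lemma gruss_endpoint {f u : R -> R} {e x l c K L v : R} :
  I x -> `|e| = 1 ->
  (forall k, e * (iter k beta x - iter k.+1 beta x)
             = `|iter k beta x - iter k.+1 beta x|) ->
  (forall k, `|f (iter k beta x) - c| <= K) ->
  (forall k, `|u (iter k beta x) - u (iter k.+1 beta x)|
             <= L * `|iter k beta x - iter k.+1 beta x|) ->
  cvgn (series (beta_term beta (fun t => `|f t|) x)) ->
  u (iter n beta x) @[n --> \oo] --> l ->
  `|v| <= L ->
  `|e * (beta_RS_integral0 beta f u x - v * beta_integral0 beta f x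
         - c * (u x - l - v * (x - s0)))|
  <= K * (L * (e * (x - s0)) - v / L * (e * (u x - l))).
Proof.
move=> Ix e1 ew fK uL cf ul vL.
have cw := series_scale e (series_telescope (beta_iter_cvg Ix)).
have cd := series_scale e (series_telescope ul).
(* For [e = -1] the integrability series has nonpositive terms; multiplying by [e] turns it into a
   series of absolute values, which dominates the terms of [cB] and, up to the factor [L], those of
   [cA]. *)
have cnf : cvgn (series (fun k =>
    `|iter k beta x - iter k.+1 beta x| * `|f (iter k beta x)|)).
  rewrite (_ : (fun k => _) = e *: beta_term beta (fun t => `|f t|) x).
    exact: is_cvg_seriesZ.
  by apply/funext => k; rewrite -ew -mulrA.
have cB : cvgn (series (beta_term beta f x)).
  apply: normed_cvg; rewrite [X in cvgn X](_ : _ = series (fun k =>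
    `|iter k beta x - iter k.+1 beta x| * `|f (iter k beta x)|)) //.
  by congr series; apply/funext => k; rewrite /= normrM.
have cA : cvgn (series (fun k =>
    f (iter k beta x) * (u (iter k beta x) - u (iter k.+1 beta x)))).
  apply: normed_cvg; apply: (@series_le_cvg _ _ (fun k => L *
    (`|iter k beta x - iter k.+1 beta x| * `|f (iter k beta x)|))).
  - by move=> k /=.
  - move=> k; rewrite !mulr_ge0 //; exact: le_trans vL.
  - by move=> k /=; rewrite normrM mulrC mulrA ler_wpM2r.
  - exact: (is_cvg_seriesZ (k := L) cnf).
have := @gruss_series R (fun k => f (iter k beta x))
  (fun k => e * (u (iter k beta x) - u (iter k.+1 beta x)))
  (fun k => e * (iter k beta x - iter k.+1 beta x))
  (e * beta_RS_integral0 beta f u x) (e * beta_integral0 beta f x)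
  _ _ c K L v _ fK vL _ _ cd cw.
rewrite /= (_ : _ - _ = e * (beta_RS_integral0 beta f u x
  - v * beta_integral0 beta f x - c * (u x - l - v * (x - s0)))); last by ring.
apply.
- by move=> k; rewrite ew normrM e1 mul1r.
- rewrite (_ : (fun k => _) = (fun k => e * (f (iter k beta x)
    * (u (iter k beta x) - u (iter k.+1 beta x))))); first exact: series_scale.
  by apply/funext => k; ring.
- rewrite (_ : (fun k => _) = (fun k => e * beta_term beta f x k)).
    exact: series_scale.
  by apply/funext => k; rewrite /beta_term /=; ring.
Qed.

(** Triangle inequality along the telescoped orbit. The bounds at [a] and [b] add up to
    [L * (b - a)], which yields [|v| <= L] for the slope [v] of [u]. *)
Lemma lipschitz_limit {u : R -> R} {x l L : R} (e : R) : I x -> `|e| = 1 ->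
  (forall k, e * (iter k beta x - iter k.+1 beta x)
             = `|iter k beta x - iter k.+1 beta x|) ->
  (forall k, `|u (iter k beta x) - u (iter k.+1 beta x)|
             <= L * `|iter k beta x - iter k.+1 beta x|) ->
  u (iter n beta x) @[n --> \oo] --> l ->
  `|u x - l| <= L * (e * (x - s0)).
Proof.
move=> Ix e1 ew uL ul.
have cw := series_scale L (series_scale e (series_telescope (beta_iter_cvg Ix))).
have /cvg_norm cd := series_telescope ul.
apply: (ler_cvg_to cd cw); apply: nearW => n.
rewrite !seriesEnat /=; apply: le_trans (ler_norm_sum _ _ _) _.
by apply: ler_sum => k _; rewrite ew.
Qed.

End BetaIterates.

(** * The inequality on the whole interval *)

Lemma beta_interval_l {R : realType} (beta : R -> R) s0 a b k :
  beta_interval beta s0 a b (iter k beta a).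
Proof. by left; left; exists k. Qed.

Lemma beta_interval_r {R : realType} (beta : R -> R) s0 a b k :
  beta_interval beta s0 a b (iter k beta b).
Proof. by left; right; exists k. Qed.

Lemma beta_gruss {R : realType} {I : set R} {beta : R -> R} {s0 a b : R}
    {f u : R -> R} {m M L : R} :
  gruss_data I beta s0 a b f u m M L ->
  beta_limits_agree beta a b u ->
  `| beta_RS_integral beta a b f u
     - (u b - u a) / (b - a) * beta_integral beta a b f |
  <= 2^-1 * L * (M - m) * (b - a).
Proof.
case=> bs Ia Ib as0 sb [ia ib] fb uL [ub ua uba].
have W0 : 0 < b - a by lra.
set l := limn (fun n => u (iter n beta a)) in uba.
have {}ua : u (iter n beta a) @[n --> \oo] --> l by exact: ua.
have {}ub : u (iter n beta b) @[n --> \oo] --> l by rewrite -uba; exact: ub.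
have fK y : beta_interval beta s0 a b y -> `|f y - (m + M) / 2| <= (M - m) / 2.
  by move=> /fb /andP[fm fM]; rewrite ler_norml; apply/andP; split; lra.
have ea k : -1 * (iter k beta a - iter k.+1 beta a)
            = `|iter k beta a - iter k.+1 beta a|.
  have /andP[h _] := beta_iter_left bs k Ia (ltW as0).
  by rewrite ler0_norm ?subr_le0 // mulN1r.
have eb k : 1 * (iter k beta b - iter k.+1 beta b)
            = `|iter k beta b - iter k.+1 beta b|.
  have /andP[_ h] := beta_iter_right bs k Ib (ltW sb).
  by rewrite ger0_norm ?subr_ge0 // mul1r.
have uLa k := uL _ (beta_interval_l beta s0 a b k).
have uLb k := uL _ (beta_interval_r beta s0 a b k).
have n1 : `|-1| = 1 :> R by rewrite normrN normr1.
have la := lipschitz_limit bs (-1) Ia n1 ea uLa ua.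
have lb := lipschitz_limit bs 1 Ib (normr1 _) eb uLb ub.
set v := _ / (b - a).
have vW : v * (b - a) = u b - u a by rewrite divfK // gt_eqF.
have vL : `|v| <= L.
  rewrite normf_div (gtr0_norm W0) ler_pdivrMr //.
  rewrite (_ : u b - u a = (u b - l) - (u a - l)); last by ring.
  by apply: le_trans (ler_normB _ _) _; lra.
have Ha := gruss_endpoint bs Ia n1 ea
  (fun k => fK _ (beta_interval_l beta s0 a b k)) uLa ia ua vL.
have Hb := gruss_endpoint bs Ib (normr1 _) eb
  (fun k => fK _ (beta_interval_r beta s0 a b k)) uLb ib ub vL.
have L0 : 0 <= L by exact: le_trans vL.
have K0 : 0 <= (M - m) / 2.
  by apply: le_trans (fK s0 _); [exact: normr_ge0 | right].
set c := (m + M) / 2 in Ha Hb; set K := (M - m) / 2 in K0 Ha Hb.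
rewrite /beta_RS_integral /beta_integral.
set Ab := beta_RS_integral0 _ _ _ b in Hb *.
set Aa := beta_RS_integral0 _ _ _ a in Ha *.
set Bb := beta_integral0 _ _ b in Hb *.
set Ba := beta_integral0 _ _ a in Ha *.
set Xb := 1 * _ in Hb; set Xa := -1 * (Aa - _ - _) in Ha.
(* The common limit [l] and [s0] cancel between the endpoints, and the remaining multiple of [c]
   vanishes by the choice of [v]. *)
have -> : Ab - Aa - v * (Bb - Ba) = Xb + Xa.
  transitivity (Xb + Xa + c * ((u b - u a) - v * (b - a))).
    by rewrite /Xb /Xa; ring.
  by rewrite vW subrr mulr0 addr0.
apply: le_trans (ler_normD _ _) _.
apply: le_trans (lerD Hb Ha) _.
have -> : K * (L * (1 * (b - s0)) - v / L * (1 * (u b - l)))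
    + K * (L * (-1 * (a - s0)) - v / L * (-1 * (u a - l)))
  = K * (L * (b - a)) - K * (v / L * (u b - u a)) by ring.
rewrite -vW (_ : 2^-1 * L * (M - m) * (b - a) = K * (L * (b - a))).
  rewrite gerBl mulr_ge0 //.
  rewrite (_ : v / L * _ = v ^+ 2 / L * (b - a)); last by ring.
  by rewrite mulr_ge0 ?divr_ge0 ?sqr_ge0 // ltW.
by rewrite /K; ring.
Qed.

(** * The extremal example *)

Section Extremal.
Context {R : realType}.
Implicit Type x : R.

Definition half (t : R) : R := t / 2.

Lemma half_setting : beta_setting setT half 0.
Proof.
split => //.
- by move=> s t _ _ st; rewrite /half; lra.
- by apply: continuous_subspaceT => t; exact: cvgMl.
- by rewrite /half mul0r.
- by move=> t _; rewrite /half => h; lra.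
- by move=> t _; rewrite /half subr0; have := sqr_ge0 t; nra.
- move=> t _; rewrite /half subr0 => h.
  have : t ^+ 2 = 0 by lra.
  by move/eqP; rewrite sqrf_eq0 => /eqP.
Qed.

Lemma abs_half x : `|half x| = half `|x|.
Proof. by rewrite normrM [`|2^-1|]ger0_norm // invr_ge0. Qed.

Lemma half_step_sg x : (x - half x) * `|Num.sg x| = x - half x.
Proof.
case: (eqVneq x 0) => [->|x0]; first by rewrite /half; ring.
by rewrite normr_sg x0 mulr1.
Qed.

Lemma sg_half_step_abs x : Num.sg x * (`|x| - `|half x|) = x - half x.
Proof. by rewrite abs_half /half mulrBr mulrA -numEsg. Qed.

(** Serves both the integrability of [|sgn|] and the Stieltjes integral of [sgn] against the
    absolute value: their terms are the plain orbit steps. *)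
Lemma half_series x (g : R^nat) :
  (forall k, g k = iter k half x - half (iter k half x)) ->
  series g @ \oo --> x.
Proof.
move=> gE; rewrite (_ : g = fun k => iter k half x - iter k.+1 half x).
  have := series_telescope (beta_iter_cvg half_setting (x := x) Logic.I).
  by rewrite subr0.
exact/funext.
Qed.

Lemma half_gruss_data : gruss_data setT half 0 (-1) 1 Num.sg Num.norm (-1) 1 1.
Proof.
split => //.
- exact: half_setting.
- split; apply: cvgP; apply: half_series => // k; exact: half_step_sg.
- by move=> x _; rewrite -ler_norml normr_sg; case: (x != 0).
- by move=> x _; rewrite mul1r; exact: ler_dist_dist.
Qed.

End Extremal.

Theorem corollary4p7 (R : realType) :
  [/\ (forall (I : set R) (beta : R -> R) (s0 a b : R) (f u : R -> R)
         (m M L : R),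
         gruss_data I beta s0 a b f u m M L ->
         beta_limits_agree beta a b u ->
         `| beta_RS_integral beta a b f u
            - (u b - u a) / (b - a) * beta_integral beta a b f |
           <= 2^-1 * L * (M - m) * (b - a)),
      (forall (I : set R) (beta : R -> R) (s0 a b : R) (f u : R -> R)
         (m M L : R),
         gruss_data I beta s0 a b f u m M L ->
         {for s0, continuous u} ->
         `| beta_RS_integral beta a b f u
            - (u b - u a) / (b - a) * beta_integral beta a b f |
           <= 2^-1 * L * (M - m) * (b - a)) &
      (forall c : R, c < 2^-1 ->
         ~ (forall (I : set R) (beta : R -> R) (s0 a b : R) (f u : R -> R)
              (m M L : R),
              gruss_data I beta s0 a b f u m M L ->
              beta_limits_agree beta a b u ->
              `| beta_RS_integral beta a b f u
                 - (u b - u a) / (b - a) * beta_integral beta a b f |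
                <= c * L * (M - m) * (b - a)))].
Proof.
split=> [I beta s0 a b f u m M L|I beta s0 a b f u m M L gd uc|c c2 H].
- exact: beta_gruss.
- apply: (beta_gruss gd).
  (* Both orbits tend to [s0], so continuity gives the common limit [u s0]. *)
  have lim x : I x -> u (iter n beta x) @[n --> \oo] --> u s0.
    move=> Ix; have xs := beta_iter_cvg (gd_setting gd) Ix.
    exact: (@cvg_comp _ _ _ (fun n => iter n beta x) u _ _ _ xs uc).
  have la := lim _ (gd_a_in gd); have lb := lim _ (gd_b_in gd).
  split; [exact: cvgP lb | exact: cvgP la |].
  by rewrite (cvg_lim _ la) ?(cvg_lim _ lb).
- have hd := @half_gruss_data R.
  have lim x : `|iter n half x| @[n --> \oo] --> (0 : R).
    have /cvg_norm := beta_iter_cvg half_setting (x := x) Logic.I.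
    by rewrite normr0.
  have agree : beta_limits_agree half (-1) 1 (Num.norm : R -> R).
    split; [exact: cvgP (lim _) | exact: cvgP (lim _) |].
    by rewrite !(cvg_lim _ (lim _)).
  have RS x : beta_RS_integral0 half Num.sg Num.norm x = x.
    apply: cvg_lim => //; apply: half_series => k; exact: sg_half_step_abs.
  have := H _ _ _ _ _ _ _ _ _ _ hd agree.
  (* Since [|1| = |-1|], the slope is zero and the left side is [1 - -1 = 2]; the right side is
     [4 c], which is less than 2. *)
  rewrite /beta_RS_integral !RS normrN subrr !mul0r subr0.
  by rewrite (_ : 1 - -1 = 2 :> R) ?[`|2|]ger0_norm//; lra.
Qed.
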